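(* Let $\mathfrak{c}$ be a subset of $\mathfrak{u}(T_n)$ with $|\mathfrak{c}| \ge 4$. Then $\mathfrak{c}$ is a circuit of the tiling matroid $\mathcal{T}_n$ if and only if both of the following hold: (1) the triangular hull of $\mathfrak{c}$ is the only lattice upward triangle of $T_n$ strictly over-saturated by $\mathfrak{c}$; (2) the minimum number of type-2 trapezoids used in a tiling of $T_n \setminus A(\mathfrak{c})$ into unit rhombi and unit trapezoids (type-1 and type-2 trapezoids) is $1$.
   Context: $T_n$ is a closed equilateral triangle of side length $n$ with horizontal base and apex up, subdivided by lines parallel to its sides at integer distances into unit equilateral triangles; upward-pointing ones are unit upward triangles (set $\mathfrak{u}(T_n)$), downward-pointing ones unit downward triangles. A lattice upward triangle of size $k$ is a translate of $T_k$ contained in $T_n$ that is a union of unit triangles; $\mathfrak{u}(T)$ is the set of unit upward triangles inside $T$. The tiling matroid $\mathcal{T}_n$ has ground set $\mathfrak{u}(T_n)$ and independent sets the $\mathfrak{s}$ with $|\mathfrak{s}\cap\mathfrak{u}(T)|\le k$ for every lattice upward triangle $T$ of size $k$; a circuit is a minimal dependent set. $T$ of size $k$ is strictly over-saturated by $\mathfrak{s}$ if $|\mathfrak{s}\cap\mathfrak{u}(T)|>k$. The triangular hull of $\mathfrak{c}$ is the smallest lattice upward triangle containing all triangles of $\mathfrak{c}$. $A(\mathfrak{c})$ is the union of the triangles in $\mathfrak{c}$. A tiling of a lattice region (nonempty subset of $T_n$ whose closure is a union of unit triangles) is a collection of closed lattice regions with pairwise disjoint interiors whose union is the closure of the region.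 A unit rhombus is the union of two unit triangles sharing an edge. A type-1 trapezoid is a lattice trapezoid that is the union of two unit upward triangles and one unit downward triangle; a type-2 trapezoid is a lattice trapezoid that is the union of one unit upward triangle and two unit downward triangles. *)

(* Defs.v *)
From mathcomp Require Import all_boot.

Set Implicit Arguments.
Unset Strict Implicit.
Unset Printing Implicit Defensive.

(* A pair (x, y) stands for the point x e1 + y e2 of the triangular lattice,  *)
(* where e1 is the unit vector along the horizontal base of T_n and e2 is e1  *)
(* rotated by 60 degrees. Thus T_n is the set x, y >= 0, x + y <= n.          *)
Definition point : Type := (nat * nat)%type.

(* Unit triangles of T_n. An upward one is located by its lower left vertex;  *)
(* the downward one located at (x, y) is the other half of the unit           *)
(* parallelogram with lower left vertex (x, y).                               *)
Definition up (n : nat) : Type := {p : 'I_n * 'I_n | p.1 + p.2 < n}.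
Definition down (n : nat) : Type := {p : 'I_n * 'I_n | p.1 + p.2 + 1 < n}.
Definition unit_triangle (n : nat) : Type := (up n + down n)%type.

Definition vertices (n : nat) (t : unit_triangle n) : seq point :=
  match t with
  | inl u => let: (x, y) := val u in
             [:: (x : nat, y : nat); (x.+1, y : nat); (x : nat, y.+1)]
  | inr d => let: (x, y) := val d in
             [:: (x.+1, y : nat); (x : nat, y.+1); (x.+1, y.+1)]
  end.

(* The triple (x, y, k) is the lattice upward triangle of size k whose lower  *)
(* left vertex is (x, y).                                                     *)
Definition lattice_triangle (n : nat) : Type :=
  {t : 'I_n * 'I_n * 'I_n.+1 | (0 < t.2) && (t.1.1 + t.1.2 + t.2 <= n)}.

Definition tsize (n : nat) (T : lattice_triangle n) : nat := (val T).2.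

Definition point_in (n : nat) (T : lattice_triangle n) (p : point) : bool :=
  let: (x, y, k) := val T in
  [&& x <= p.1, y <= p.2 & p.1 + p.2 <= x + y + k].

(* By convexity, a unit triangle is contained in T iff its vertices are.      *)
Definition triangles_in (n : nat) (T : lattice_triangle n) :
    {set unit_triangle n} :=
  [set t | all (point_in T) (vertices t)].

Definition ups_in (n : nat) (T : lattice_triangle n) : {set up n} :=
  [set u | inl u \in triangles_in T].

Definition independent (n : nat) (s : {set up n}) : bool :=
  [forall T : lattice_triangle n, #|s :&: ups_in T| <= tsize T].

Definition circuit (n : nat) (c : {set up n}) : bool :=
  minset (fun s : {set up n} => ~~ independent s) c.

Definition strictly_oversaturated (n : nat) (s : {set up n})
    (T : lattice_triangle n) : bool :=
  tsize T < #|s :&: ups_in T|.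

Definition triangular_hull (n : nat) (c : {set up n})
    (H : lattice_triangle n) : Prop :=
  c \subset ups_in H /\
  forall T : lattice_triangle n,
    c \subset ups_in T -> triangles_in H \subset triangles_in T.

(* A closed lattice region is encoded by the set of unit triangles of which   *)
(* it is the union. The closure of T_n \ A(c) is the union of the unit        *)
(* triangles of T_n not in c.                                                 *)
Definition complement_region (n : nat) (c : {set up n}) :
    {set unit_triangle n} :=
  ~: [set inl u | u in c].

Definition share_edge (n : nat) (s t : unit_triangle n) : bool :=
  count [in vertices t] (vertices s) == 2.

Definition unit_rhombus (n : nat) (R : {set unit_triangle n}) : bool :=
  [exists s, exists t, share_edge s t && (R == [set s; t])].

(* Two upward and one downward unit triangles form a trapezoid iff the        *)
(* downward one shares an edge with each of the upward ones; symmetrically    *)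
(* for type 2.                                                                *)
Definition type1_trapezoid (n : nat) (R : {set unit_triangle n}) : bool :=
  [exists d : down n, exists u : up n, exists v : up n,
    [&& u != v, share_edge (inr d) (inl u), share_edge (inr d) (inl v)
      & R == [set inl u; inl v; inr d]]].

Definition type2_trapezoid (n : nat) (R : {set unit_triangle n}) : bool :=
  [exists u : up n, exists d : down n, exists e : down n,
    [&& d != e, share_edge (inl u) (inr d), share_edge (inl u) (inr e)
      & R == [set inr d; inr e; inl u]]].

(* Tilings into unit rhombi and unit trapezoids: disjointness of interiors is *)
(* disjointness of the sets of unit triangles.                                *)
Definition rt_tiling (n : nat) (D : {set unit_triangle n})
    (P : {set {set unit_triangle n}}) : Prop :=
  partition P D /\
  forall R, R \in P ->
    [|| unit_rhombus R, type1_trapezoid R | type2_trapezoid R].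

Definition num_type2 (n : nat) (P : {set {set unit_triangle n}}) : nat :=
  #|[set R in P | type2_trapezoid R]|.

(* In particular some tiling exists. *)
Definition min_type2 (n : nat) (D : {set unit_triangle n}) (m : nat) : Prop :=
  (exists2 P, rt_tiling D P & num_type2 P = m) /\
  (forall P, rt_tiling D P -> m <= num_type2 P).

(* Main.v *)
From mathcomp Require Import all_boot zify.
Require Import Defs.

Set Implicit Arguments.
Unset Strict Implicit.
Unset Printing Implicit Defensive.

(* Counting the tiles that meet a lattice triangle T shows that T contains at *)
(* most tsize T + m elements of c if T_n \ A(c) has a tiling with m type-2    *)
(* trapezoids, since every tile contains, next to each of its downward        *)
(* triangles in T, an upward one in T. Hence a dependent c forces m >= 1, and *)
(* m = 1 gives |c| <= tsize H + 1 for the hull H, so c is minimal dependent.  *)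
(*                                                                            *)
(* Conversely, let c be a circuit with hull H, and u0 in c. By Hall's theorem *)
(* c \ u0 admits a matching of all downward triangles with adjacent upward    *)
(* ones outside c \ u0. Inside H this matching is a bijection, so it pairs u0 *)
(* with some d0. Deleting this pair leaves a rhombus tiling of H \ A(c) minus *)
(* d0, and d0 can be glued to a rhombus through a neighbour v0 not in c; here *)
(* |c| >= 4 is needed, as otherwise c could consist of the neighbours of d0.  *)
(* The rest of T_n is cut into strips along H, each of which is tiled by      *)
(* rhombi and one type-1 trapezoid.                                           *)

(** Everything rests on the surplus in [card_ups_in]: a lattice triangle of size k has k more upward
    than downward units. Applied to tiles, it bounds saturation by the number of type-2 trapezoids
    ([tiling_oversaturation]). Applied to an independent s, it says that the downward units of a
    triangle never outnumber its upward units outside s. Since [closed_downs_triangle] splits closed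
    sets of downward units into such triangles, Hall's condition follows ([independent_hall]).
    [circuit_tiling] joins the resulting matching inside the hull to [outer_assignment] outside it.
    Condition (1) comes from intersecting triangles ([oversaturated_least], [circuit_hull]). *)

(** * Coordinates *)

Definition ux n (u : up n) : nat := (val u).1.
Definition uy n (u : up n) : nat := (val u).2.
Definition dx n (d : down n) : nat := (val d).1.
Definition dy n (d : down n) : nat := (val d).2.
Definition tx n (T : lattice_triangle n) : nat := (val T).1.1.
Definition ty n (T : lattice_triangle n) : nat := (val T).1.2.

Lemma up_inj n (u v : up n) : ux u = ux v -> uy u = uy v -> u = v.
Proof.
case: u v => [[x y] h] [[x' y'] h']; rewrite /ux /uy /= => e1 e2.
by apply/val_inj; congr (_, _); apply/val_inj.
Qed.

Lemma down_inj n (d e : down n) : dx d = dx e -> dy d = dy e -> d = e.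
Proof.
case: d e => [[x y] h] [[x' y'] h']; rewrite /dx /dy /= => e1 e2.
by apply/val_inj; congr (_, _); apply/val_inj.
Qed.

Lemma tri_inj n (S T : lattice_triangle n) :
  tx S = tx T -> ty S = ty T -> tsize S = tsize T -> S = T.
Proof.
case: S T => [[[x y] k] h] [[[x' y'] k'] h']; rewrite /tx /ty /tsize /=.
move=> e1 e2 e3.
by apply/val_inj; congr (_, _, _); apply/val_inj.
Qed.

Lemma up_lt n (u : up n) : ux u + uy u < n.
Proof. by case: u. Qed.

Lemma down_lt n (d : down n) : dx d + dy d + 1 < n.
Proof. by case: d. Qed.

Lemma tri_le n (T : lattice_triangle n) :
  0 < tsize T /\ tx T + ty T + tsize T <= n.
Proof. by have /andP := valP T. Qed.

Lemma up_ex n x y : x + y < n -> exists u : up n, ux u = x /\ uy u = y.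
Proof.
move=> h; have hx : x < n by lia. have hy : y < n by lia.
by exists (exist _ (Ordinal hx, Ordinal hy) h).
Qed.

Lemma down_ex n x y : x + y + 1 < n -> exists d : down n, dx d = x /\ dy d = y.
Proof.
move=> h; have hx : x < n by lia. have hy : y < n by lia.
by exists (exist _ (Ordinal hx, Ordinal hy) h).
Qed.

Lemma tri_ex n x y k : 0 < k -> x + y + k <= n ->
  exists T : lattice_triangle n, [/\ tx T = x, ty T = y & tsize T = k].
Proof.
move=> k0 h; have hx : x < n by lia. have hy : y < n by lia.
have hk : k < n.+1 by lia.
have hT : (0 < k) && (x + y + k <= n) by rewrite k0.
by exists (exist _ (Ordinal hx, Ordinal hy, Ordinal hk) hT).
Qed.

Definition downs_in n (T : lattice_triangle n) : {set down n} :=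
  [set d | inr d \in triangles_in T].

Lemma ups_inE n (T : lattice_triangle n) u :
  (u \in ups_in T) =
  [&& tx T <= ux u, ty T <= uy u & ux u + uy u < tx T + ty T + tsize T].
Proof.
rewrite !inE /point_in /tx /ty /tsize /ux /uy /=.
case: T => [[[a b] k] h]; case: u => [[x y] h'] /=; lia.
Qed.

Lemma downs_inE n (T : lattice_triangle n) d :
  (d \in downs_in T) =
  [&& tx T <= dx d, ty T <= dy d & dx d + dy d + 1 < tx T + ty T + tsize T].
Proof.
rewrite !inE /point_in /tx /ty /tsize /dx /dy /=.
case: T => [[[a b] k] h]; case: d => [[x y] h'] /=; lia.
Qed.

(** Edge sharing in coordinates, in a form that [lia] can decide; [share_edge_du] justifies it. *)
Definition adj n (d : down n) (u : up n) : bool :=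
  [|| (ux u == dx d) && (uy u == dy d),
      (ux u == (dx d).+1) && (uy u == dy d)
    | (ux u == dx d) && (uy u == (dy d).+1)].

Ltac decide_nat_eqs :=
  repeat match goal with |- context [?a == ?b :> nat] =>
    first [ have -> : (a == b) = true by lia
          | have -> : (a == b) = false by lia ]
  end.

Lemma share_edgeC n (s t : unit_triangle n) : share_edge s t = share_edge t s.
Proof.
have uniqV (r : unit_triangle n) : uniq (vertices r).
  case: r => [] [[x y] h] /=; rewrite !inE !xpair_eqE; lia.
rewrite /share_edge -!size_filter; congr (_ == _); apply/perm_size.
apply: uniq_perm; rewrite ?filter_uniq // => p.
by rewrite !mem_filter andbC.
Qed.

Lemma share_edge_du n (d : down n) (u : up n) :
  share_edge (inr d) (inl u) = adj d u.
Proof.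
rewrite /share_edge /adj /ux /uy /dx /dy.
case: d u => [[x y] h] [[x' y'] h'] /=.
move: (nat_of_ord x) (nat_of_ord y) (nat_of_ord x') (nat_of_ord y').
move=> {h h'}{}x {}y {}x' {}y'.
rewrite !inE !xpair_eqE !eqSS.
(* Vertices can coincide only if the coordinates differ by at most 1, so all larger offsets form a
   single case. *)
have [xx|[xx|[xx|xx]]] :
    x' = x \/ x' = x.+1 \/ x = x'.+1 \/ (x' + 1 < x \/ x + 1 < x')
    by lia.
all: have [yy|[yy|[yy|yy]]] :
    y' = y \/ y' = y.+1 \/ y = y'.+1 \/ (y' + 1 < y \/ y + 1 < y')
    by lia.
all: by decide_nat_eqs.
Qed.

Lemma share_edge_ud n (d : down n) (u : up n) :
  share_edge (inl u) (inr d) = adj d u.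
Proof. by rewrite share_edgeC share_edge_du. Qed.

Lemma share_edge_dd n (d e : down n) : share_edge (inr d) (inr e) = false.
Proof.
rewrite /share_edge.
case: d e => [[x y] h] [[x' y'] h'] /=.
move: (nat_of_ord x) (nat_of_ord y) (nat_of_ord x') (nat_of_ord y').
move=> {h h'}{}x {}y {}x' {}y'.
rewrite !inE !xpair_eqE !eqSS.
have [xx|[xx|[xx|xx]]] :
    x' = x \/ x' = x.+1 \/ x = x'.+1 \/ (x' + 1 < x \/ x + 1 < x')
    by lia.
all: have [yy|[yy|[yy|yy]]] :
    y' = y \/ y' = y.+1 \/ y = y'.+1 \/ (y' + 1 < y \/ y + 1 < y')
    by lia.
all: by decide_nat_eqs.
Qed.

Lemma adj_in n (T : lattice_triangle n) d u :
  d \in downs_in T -> adj d u -> u \in ups_in T.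
Proof. rewrite downs_inE ups_inE /adj; lia. Qed.

Definition nbr n (d : down n) : {set up n} := [set u | adj d u].

Lemma card_nbr n (d : down n) : #|nbr d| = 3.
Proof.
have h := down_lt d.
have [|u [u1 u2]] := @up_ex n (dx d) (dy d); first lia.
have [|v [v1 v2]] := @up_ex n (dx d).+1 (dy d); first lia.
have [|w [w1 w2]] := @up_ex n (dx d) (dy d).+1; first lia.
have -> : nbr d = [set u; v; w].
  apply/setP => t; rewrite !inE /adj -orbA.
  apply/idP/idP.
    case/or3P => /andP[/eqP e1 /eqP e2]; apply/or3P.
    - by constructor 1; apply/eqP/up_inj; lia.
    - by constructor 2; apply/eqP/up_inj; lia.
    - by constructor 3; apply/eqP/up_inj; lia.
  by case/or3P => /eqP ->; lia.
rewrite -setUA cardsU1 cards2 !inE.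
have -> : (u == v) = false by apply/eqP => e; move: v1; rewrite -e; lia.
have -> : (u == w) = false by apply/eqP => e; move: w2; rewrite -e; lia.
by have -> : (v == w) = false by apply/eqP => e; move: w2; rewrite -e; lia.
Qed.

(** Each downward unit is paired with the upward unit at the same coordinates ([f]); the upward
    units left over are those along the slanted right side of T ([g]). *)
Lemma card_ups_in n (T : lattice_triangle n) :
  #|ups_in T| = #|downs_in T| + tsize T.
Proof.
have [k0 hk] := tri_le T.
have /fin_all_exists[f fP] (d : down n) :
    exists u : up n, ux u = dx d /\ uy u = dy d.
  by apply: up_ex; have := down_lt d; lia.
have /fin_all_exists[g gP] (i : 'I_(tsize T)) :
    exists u : up n, ux u = tx T + i /\ uy u = ty T + (tsize T - i.+1).
  by apply: up_ex; have := ltn_ord i; lia.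
have finj : injective f.
  move=> d e h; have [h1 h2] := fP d; have [h3 h4] := fP e.
  by apply: down_inj; rewrite -?h1 -?h2 h.
have ginj : injective g.
  move=> i j h; have [h1 h2] := gP i; have [h3 h4] := gP j.
  by apply/val_inj; rewrite /= ; move: h1 h3; rewrite h; lia.
rewrite -(card_imset _ finj) -[in RHS](card_ord (tsize T)) -cardsT.
rewrite -(card_imset _ ginj) -cardsUI.
rewrite (_ : _ :&: _ = set0) ?cards0 ?addn0; last first.
  apply/setP => u; rewrite !inE; apply/negP => /andP[/imsetP[d dT ->]].
  case/imsetP => i _ h; move: dT; rewrite downs_inE.
  have := fP d; have := gP i; rewrite h; have := ltn_ord i; lia.
congr #|pred_of_set _|; apply/setP => u; rewrite in_setU.
apply/idP/orP.
  rewrite ups_inE => hu; case: (ltnP (ux u + uy u + 1) (tx T + ty T + tsize T)) => hs.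
    left; have [|d [d1 d2]] := @down_ex n (ux u) (uy u); first lia.
    apply/imsetP; exists d; first by rewrite downs_inE; lia.
    by have [? ?] := fP d; apply: up_inj; lia.
  right; have hi : ux u - tx T < tsize T by lia.
  apply/imsetP; exists (Ordinal hi) => //.
  by have [/= ? ?] := gP (Ordinal hi); apply: up_inj; lia.
case=> /imsetP[i iT ->]; rewrite ups_inE.
  by move: iT; rewrite downs_inE; have := fP i; lia.
by have := gP i; have := ltn_ord i; lia.
Qed.

(** * Matchings *)

(* Rado's proof: shrink some N a of size at least 2. If neither b1 nor b2     *)
(* could be deleted from N a, the two violating sets would by submodularity   *)
(* contradict the hypothesis.                                                 *)
Theorem hall_marriage (A B : finType) (N : A -> {set B}) :
  (forall X : {set A}, #|X| <= #|\bigcup_(x in X) N x|) ->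
  exists f : A -> B, injective f /\ forall x, f x \in N x.
Proof.
have [m] := ubnP (\sum_x #|N x|); elim: m N => // m IHm N le_m hN.
have [/existsP[a]|] := boolP [exists a, 1 < #|N a|]; last first.
  rewrite negb_exists => /forallP N1.
  have /fin_all_exists[f fP] a : exists b, N a = [set b].
    apply/cards1P; have := N1 a; have := hN [set a].
    by rewrite big_set1 cards1; lia.
  exists f; split=> [a b fab|a]; last by rewrite fP set11.
  have := hN [set a; b]; rewrite cards2.
  case: eqP => // _; rewrite bigcup_setU !big_set1 !fP fab setUid cards1.
  by [].
case/card_gt1P => b1 [b2 [b1N b2N b12]].
pose del b x := if x == a then N x :\ b else N x.
have del_hall b : b \in N a ->
    (forall X : {set A}, #|X| <= #|\bigcup_(x in X) del b x|) ->
    exists f : A -> B, injective f /\ forall x, f x \in N x.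
  move=> bN hdel; have [||f [f_inj fP]] := IHm (del b) => //.
    rewrite (leq_trans _ (_ : \sum_x #|N x| <= m)) //.
    rewrite (bigD1 a) //= [X in _ < X](bigD1 a) //= {1}/del eqxx.
    rewrite (cardsD1 b (N a)) bN add1n ltnS leq_add2l.
    by apply: leq_sum => x /negPf xa; rewrite /del xa.
  exists f; split=> // x; have := fP x; rewrite /del; case: ifP => // _.
  by case/setD1P.
(* A set violating the condition after the deletion must contain a, the only index whose set
   changed; a is split off. *)
have bad b : ~~ [forall X : {set A}, #|X| <= #|\bigcup_(x in X) del b x|] ->
    exists X : {set A}, a \notin X /\
      #|(\bigcup_(x in X) N x) :|: (N a :\ b)| <= #|X|.
  rewrite negb_forall => /existsP[X]; rewrite -ltnNge => hX.
  have aX : a \in X.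
    apply: contraLR hX => aX; rewrite -leqNgt.
    rewrite (eq_bigr N) ?hN // => x xX; rewrite /del.
    by case: eqP => // xa; rewrite -xa xX in aX.
  exists (X :\ a); rewrite setD11; split=> //.
  move: hX; rewrite (cardsD1 a X) aX add1n ltnS (big_setD1 a) //= {1}/del eqxx.
  rewrite setUC (eq_bigr N) // => x /setD1P[/negPf xa _].
  by rewrite /del xa.
have [/forallP h1|/bad[X1 [aX1 hX1]]] :=
  boolP [forall X : {set A}, #|X| <= #|\bigcup_(x in X) del b1 x|].
  exact: (del_hall b1).
have [/forallP h2|/bad[X2 [aX2 hX2]]] :=
  boolP [forall X : {set A}, #|X| <= #|\bigcup_(x in X) del b2 x|].
  exact: (del_hall b2).
have hU := hN (a |: (X1 :|: X2)).
have hI := hN (X1 :&: X2).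
rewrite cardsU1 !inE (negPf aX1) (negPf aX2) /= in hU.
set Y1 := _ :|: _ in hX1; set Y2 := _ :|: _ in hX2.
have sU : \bigcup_(x in a |: (X1 :|: X2)) N x \subset Y1 :|: Y2.
  apply/bigcupsP => x; rewrite !inE => /or3P[/eqP ->|x1|x2]; last 2 first.
  - by apply/subsetP => y yN; rewrite !inE; apply/orP; left; apply/orP; left;
      apply/bigcupP; exists x.
  - by apply/subsetP => y yN; rewrite !inE; apply/orP; right; apply/orP; left;
      apply/bigcupP; exists x.
  (* As b1 and b2 differ, the two deletions from [N a] together still cover [N a]. *)
  apply/subsetP => y yN; rewrite !inE yN !andbT.
  have [->|_] := eqVneq y b1; last by rewrite orbT.
  by rewrite b12 !orbT.
have sI : \bigcup_(x in X1 :&: X2) N x \subset Y1 :&: Y2.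
  apply/bigcupsP => x /setIP[x1 x2]; apply/subsetP => y yN; rewrite !inE.
  by apply/andP; split; apply/orP; left; apply/bigcupP; exists x.
have := subset_leq_card sU; have := subset_leq_card sI.
have := cardsUI X1 X2; have := cardsUI Y1 Y2; lia.
Qed.

Definition nbrs n (X : {set down n}) : {set up n} := \bigcup_(d in X) nbr d.

Lemma nbrsP n (X : {set down n}) u :
  reflect (exists2 d, d \in X & adj d u) (u \in nbrs X).
Proof.
by apply: (iffP bigcupP) => -[d dX du]; exists d => //; rewrite inE in du *.
Qed.

(* Since d has three neighbours, adding d to X adds at most one element to    *)
(* nbrs X unless X is closed at d; so Hall's condition reduces to closed X.   *)
Definition closed_downs n (X : {set down n}) : Prop :=
  forall d u v, u != v -> adj d u -> adj d v ->
    u \in nbrs X -> v \in nbrs X -> d \in X.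

Lemma spread_along_strip (S : nat -> Prop) k i :
  i < k -> S i -> (forall j, j.+1 < k -> S j <-> S j.+1) ->
  forall j, j < k -> S j.
Proof.
move=> ik Si step.
have S0 : S 0.
  elim: i ik Si => // i IH ik Si.
  by apply: IH; [lia|have [_] := step i ik; apply].
elim=> // j IH jk; have [Sj _] := step j jk; apply: Sj; apply: IH; lia.
Qed.

(* A largest triangle of X works: an element of X touching it from outside    *)
(* would force the whole adjacent strip into X.                               *)
Lemma closed_downs_triangle n (X : {set down n}) :
  closed_downs X -> X != set0 ->
  exists T : lattice_triangle n,
    [/\ downs_in T != set0, downs_in T \subset X, ups_in T \subset nbrs X
      & forall d u, d \in X -> adj d u -> u \in ups_in T -> d \in downs_in T].
Proof.
move=> clX /set0Pn[d0 d0X].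
(* [D] and [V] express membership in X and in [nbrs X] by coordinates. *)
pose D x y := exists2 d, d \in X & dx d = x /\ dy d = y.
pose V x y := exists2 u, u \in nbrs X & ux u = x /\ uy u = y.
have DV x y : D x y -> [/\ V x y, V x.+1 y & V x y.+1].
  case=> d dX [dx_ dy_]; have := down_lt d; rewrite dx_ dy_ => hd.
  split.
  - have [|u [u1 u2]] := @up_ex n x y; first lia.
    by exists u => //; apply/nbrsP; exists d => //; rewrite /adj; lia.
  - have [|u [u1 u2]] := @up_ex n x.+1 y; first lia.
    by exists u => //; apply/nbrsP; exists d => //; rewrite /adj; lia.
  - have [|u [u1 u2]] := @up_ex n x y.+1; first lia.
    by exists u => //; apply/nbrsP; exists d => //; rewrite /adj; lia.
have VD x y u v : x + y + 1 < n -> u \in nbrs X -> v \in nbrs X -> u != v ->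
    (forall d, dx d = x -> dy d = y -> adj d u && adj d v) -> D x y.
  move=> /down_ex[d [d1 d2]] uX vX uv /(_ d d1 d2)/andP[du dv].
  by exists d => //; apply: (clX d u v).
have cl_lr x y : x + y + 1 < n -> V x y -> V x.+1 y -> D x y.
  move=> h [u uX [u1 u2]] [v vX [v1 v2]]; apply: (VD x y u v) => //.
    by apply/eqP => e; move: v1; rewrite -e; lia.
  by move=> d d1 d2; rewrite /adj; lia.
have cl_lt x y : x + y + 1 < n -> V x y -> V x y.+1 -> D x y.
  move=> h [u uX [u1 u2]] [v vX [v1 v2]]; apply: (VD x y u v) => //.
    by apply/eqP => e; move: v2; rewrite -e; lia.
  by move=> d d1 d2; rewrite /adj; lia.
have cl_rt x y : x + y + 1 < n -> V x.+1 y -> V x y.+1 -> D x y.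
  move=> h [u uX [u1 u2]] [v vX [v1 v2]]; apply: (VD x y u v) => //.
    by apply/eqP => e; move: v2; rewrite -e; lia.
  by move=> d d1 d2; rewrite /adj; lia.
(* A triangle of size 2 has d0 as its only downward unit, so the maximum is taken over a nonempty
   family. *)
have [|T0 [x0 y0 k0]] := @tri_ex n (dx d0) (dy d0) 2 isT.
  by have := down_lt d0; lia.
have T0X : downs_in T0 \subset X.
  apply/subsetP => d; rewrite downs_inE => hd.
  by rewrite (_ : d = d0) //; apply: down_inj; lia.
have [T TX maxT] := @arg_maxnP _ T0 (fun T => downs_in T \subset X) (@tsize n) T0X.
have k2 : 2 <= tsize T by rewrite -k0; apply: maxT.
have [_ leT] := tri_le T.
have DT x y : tx T <= x -> ty T <= y -> x + y + 1 < tx T + ty T + tsize T -> D x y.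
  move=> h1 h2 h3; have [|d [d1 d2]] := @down_ex n x y; first lia.
  by exists d => //; apply: (subsetP TX); rewrite downs_inE; lia.
have VT x y : tx T <= x -> ty T <= y -> x + y < tx T + ty T + tsize T -> V x y.
  move=> h1 h2 h3; have [h|h] := ltnP (x + y + 1) (tx T + ty T + tsize T).
    by have [] := DV _ _ (DT x y h1 h2 h).
  have [h4|h4] := ltnP (tx T) x.
    have [||_] := DV _ _ (DT x.-1 y _ h2 _); [lia|lia|].
    by rewrite prednK //; lia.
  have [||_ _] := DV _ _ (DT x y.-1 h1 _ _); [lia|lia|].
  by rewrite prednK //; lia.
have nogrow (T' : lattice_triangle n) : tsize T' = (tsize T).+1 ->
    ~ (forall x y, tx T' <= x -> ty T' <= y ->
         x + y + 1 < tx T' + ty T' + tsize T' -> D x y).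
  move=> kT' h; have := maxT T'; rewrite kT' => h'.
  suff /h' : downs_in T' \subset X by rewrite /geq /=; lia.
  apply/subsetP => d; rewrite downs_inE => /and3P[d1 d2 d3].
  have [e eX [e1 e2]] := h _ _ d1 d2 d3.
  by rewrite (_ : d = e) //; apply: down_inj.
exists T; split=> //.
- have [|d [d1 d2]] := @down_ex n (tx T) (ty T); first lia.
    by apply/set0Pn; exists d; rewrite downs_inE; lia.
- apply/subsetP => u; rewrite ups_inE => /and3P[u1 u2 u3].
  have [v vX [v1 v2]] := VT _ _ u1 u2 u3.
  by rewrite (_ : u = v) //; apply: up_inj.
move=> d u dX du uT; rewrite downs_inE; apply: contraT => dT.
have hd := down_lt d; move: uT; rewrite ups_inE => uT.
have Dd : D (dx d) (dy d) by exists d.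
(* Three cases: d lies beyond the slanted side of T, to its left, or below it. In each, T extended
   by that strip would be a larger triangle of X. *)
have [hs|hs] := ltnP (tx T + ty T + tsize T) (dx d + dy d + 2).
  have [||T' [a' b' k']] := @tri_ex n (tx T) (ty T) (tsize T).+1; [lia| |].
    by move: du; rewrite /adj; lia.
  case: (nogrow T' k') => x y; rewrite a' b' k' => h1 h2 h3.
  have [h|h] := ltnP (x + y + 1) (tx T + ty T + tsize T); first exact: DT.
  have S := @spread_along_strip
    (fun i => D (tx T + i) (ty T + (tsize T).-1 - i)) (tsize T) (dx d - tx T).
  have {}S : forall j, j < tsize T -> D (tx T + j) (ty T + (tsize T).-1 - j).
    apply: S.
    - by move: du; rewrite /adj; lia.
    - have -> : tx T + (dx d - tx T) = dx d by move: du; rewrite /adj; lia.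
      have -> // : ty T + (tsize T).-1 - (dx d - tx T) = dy d.
      by move: du; rewrite /adj; lia.
    (* Consecutive downward units of the strip share an upward neighbour, and each has another one
       in T; closedness passes membership along. *)
    move=> j jk; split=> /DV[Dl Dr Dt].
      apply: cl_lt; [by lia|by apply: VT; lia|].
      have -> : tx T + j.+1 = (tx T + j).+1 by lia.
      by have -> : (ty T + (tsize T).-1 - j.+1).+1 = ty T + (tsize T).-1 - j by lia.
    apply: cl_lr; [by lia|by apply: VT; lia|].
    have -> : (tx T + j).+1 = tx T + j.+1 by lia.
    by have -> : ty T + (tsize T).-1 - j = (ty T + (tsize T).-1 - j.+1).+1 by lia.
  have -> : x = tx T + (x - tx T) by lia.
  have -> : y = ty T + (tsize T).-1 - (x - tx T) by lia.
  by apply: S; lia.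
have [ha|ha] := ltnP (dx d) (tx T).
  have [||T' [a' b' k']] := @tri_ex n (dx d) (ty T) (tsize T).+1; [lia|lia|].
  have hx : (dx d).+1 = tx T by move: du; rewrite /adj; lia.
  case: (nogrow T' k') => x y; rewrite a' b' k' => h1 h2 h3.
  have [h|h] := ltnP (dx d) x; first by apply: DT; lia.
  have S := @spread_along_strip
    (fun i => D (dx d) (ty T + i)) (tsize T) (dy d - ty T).
  have {}S : forall j, j < tsize T -> D (dx d) (ty T + j).
    apply: S.
    - by move: du; rewrite /adj; lia.
    - have -> // : ty T + (dy d - ty T) = dy d by move: du; rewrite /adj; lia.
    move=> j jk; split=> /DV[Dl Dr Dt].
      by apply: cl_lr; [lia|rewrite addnS|apply: VT; lia].
    by apply: cl_rt; [lia|apply: VT; lia|rewrite -addnS].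
  have -> : x = dx d by lia.
  have -> : y = ty T + (y - ty T) by lia.
  by apply: S; lia.
have hy : (dy d).+1 = ty T by move: du; rewrite /adj; lia.
have [||T' [a' b' k']] := @tri_ex n (tx T) (dy d) (tsize T).+1; [lia|lia|].
case: (nogrow T' k') => x y; rewrite a' b' k' => h1 h2 h3.
have [h|h] := ltnP (dy d) y; first by apply: DT; lia.
have S := @spread_along_strip
  (fun i => D (tx T + i) (dy d)) (tsize T) (dx d - tx T).
have {}S : forall j, j < tsize T -> D (tx T + j) (dy d).
  apply: S.
  - by move: du; rewrite /adj; lia.
  - have -> // : tx T + (dx d - tx T) = dx d by move: du; rewrite /adj; lia.
  move=> j jk; split=> /DV[Dl Dr Dt].
    by apply: cl_lt; [lia|rewrite addnS|apply: VT; lia].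
  by apply: cl_rt; [lia|rewrite -addnS|apply: VT; lia].
have -> : y = dy d by lia.
have -> : x = tx T + (x - tx T) by lia.
by apply: S; lia.
Qed.

Lemma independentP n (s : {set up n}) :
  reflect (forall T, #|s :&: ups_in T| <= tsize T) (independent s).
Proof. exact: forallP. Qed.

Lemma nbrsS n (X Y : {set down n}) : X \subset Y -> nbrs X \subset nbrs Y.
Proof.
move=> /subsetP XY; apply/subsetP => u /nbrsP[d /XY dY du].
by apply/nbrsP; exists d.
Qed.

(** Induction by peeling off the triangle T of [closed_downs_triangle]. Independence leaves at least
    [#|downs_in T|] upward units of T outside s, and the neighbours of the rest of X, which is still
    closed, avoid T. *)
Lemma closed_downs_hall n (s : {set up n}) (X : {set down n}) :
  independent s -> closed_downs X -> #|X| <= #|nbrs X :\: s|.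
Proof.
move=> /independentP hs; have [m] := ubnP #|X|; elim: m X => // m IHm X Xm clX.
have [->|X0] := eqVneq X set0; first by rewrite cards0.
have [T [T0 TX VT sepT]] := closed_downs_triangle clX X0.
have notT d u : d \in X :\: downs_in T -> adj d u -> u \notin ups_in T.
  by case/setDP => dX dT du; apply: contra dT => uT; apply: (sepT d u).
have XT := cardsID (downs_in T) X; rewrite (setIidPr TX) in XT.
have T1 : 0 < #|downs_in T| by rewrite card_gt0.
have clXT : closed_downs (X :\: downs_in T).
  move=> d u v uv du dv /[dup] uXT /nbrsP[e eX eu] vXT.
  rewrite inE (clX d u v) ?(subsetP (nbrsS (subsetDl X (downs_in T)))) //.
  by rewrite andbT; apply: contra (notT _ _ eX eu) => dT; apply: adj_in du.
have {IHm} IH := IHm (X :\: downs_in T) ltac:(lia) clXT.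
have sub : (ups_in T :\: s) :|: (nbrs (X :\: downs_in T) :\: s)
           \subset nbrs X :\: s.
  by rewrite -setDUl setSD // subUset VT nbrsS // subsetDl.
have dis : (ups_in T :\: s) :&: (nbrs (X :\: downs_in T) :\: s) = set0.
  apply/eqP; rewrite -subset0; apply/subsetP => u.
  case/setIP => /setDP[uT _] /setDP[/nbrsP[d dX du] _].
  by move: (notT _ _ dX du); rewrite uT.
have := subset_leq_card sub; rewrite cardsU dis cards0 subn0.
have := cardsID s (ups_in T); rewrite card_ups_in setIC; have := hs T; lia.
Qed.

(** Induction on the complement of X: a d that violates closedness is added to X, and the bound for
    the larger set gives the one for X, as at most one neighbour is new. *)
Lemma independent_hall n (s : {set up n}) (X : {set down n}) :
  independent s -> #|X| <= #|nbrs X :\: s|.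
Proof.
move=> hs; have [m] := ubnP #|~: X|; elim: m X => // m IHm X Xm.
have [|clX] := boolP [exists d, exists u, exists v,
  [&& d \notin X, u != v, adj d u, adj d v, u \in nbrs X & v \in nbrs X]].
  case/existsP => d /existsP[u /existsP[v /and5P[dX uv du dv /andP[uX vX]]]].
  have hc : #|~: (d |: X)| < m.
    rewrite setCU setIC -setDE; move: Xm.
    by rewrite (cardsD1 d (~: X)) inE dX; lia.
  have sub : nbrs (d |: X) :\: s \subset
             (nbrs X :\: s) :|: (nbr d :\: [set u; v]).
    apply/subsetP => w /setDP[/nbrsP[e]]; rewrite in_setU1 => eX ew ws.
    rewrite !inE ws; case: (boolP (w \in nbrs X)) => //= wX.
    case/predU1P: eX => [<-|eX]; last by case/nbrsP: wX; exists e.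
    by rewrite ew andbT; apply: contra wX => /orP[] /eqP ->.
  have uvd : [set u; v] \subset nbr d by rewrite subUset !sub1set !inE du.
  have w1 : #|nbr d :\: [set u; v]| = 1.
    by rewrite cardsD (setIidPr uvd) card_nbr cards2 uv.
  have := leq_trans (subset_leq_card sub) (leq_card_setU _ _); rewrite w1 => le1.
  by have := leq_trans (IHm _ hc) le1; rewrite cardsU1 dX addn1.
apply: closed_downs_hall => // d u v uv du dv uX vX.
apply: contraR clX => dX; apply/existsP; exists d; apply/existsP; exists u.
by apply/existsP; exists v; rewrite dX uv du dv uX.
Qed.

Lemma independent_matching n (s : {set up n}) : independent s ->
  exists f : down n -> up n,
    [/\ injective f, forall d, adj d (f d) & forall d, f d \notin s].
Proof.
move=> hs; have [|f [f_inj fP]] := @hall_marriage _ _ (fun d => nbr d :\: s).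
  move=> X; apply: leq_trans (independent_hall X hs) _; apply: subset_leq_card.
  apply/subsetP => u /setDP[/nbrsP[d dX du] us].
  by apply/bigcupP; exists d; rewrite // inE us inE.
by exists f; split=> // d; have := fP d; rewrite !inE => /andP[].
Qed.

(** * Circuits *)

Lemma circuit_indep_del n (c : {set up n}) u :
  circuit c -> u \in c -> independent (c :\ u).
Proof.
case/minsetP => _ minc uc; apply: contraT => /minc/(_ (subD1set c u)) cu.
by move: uc; rewrite -cu setD11.
Qed.

(** The part of c in T is already dependent, so by minimality it is all of c; deleting one element
    restores the bound [tsize T]. *)
Lemma circuit_oversaturated n (c : {set up n}) T :
  circuit c -> strictly_oversaturated c T ->
  c \subset ups_in T /\ #|c| = (tsize T).+1.
Proof.
move=> cc oT; have /minsetP[_ minc] := cc; rewrite /strictly_oversaturated in oT.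
have cT : c \subset ups_in T.
  apply/setIidPl/minc; last exact: subsetIl.
  by apply/independentP => /(_ T); rewrite -setIA setIid leqNgt oT.
split=> //; rewrite (setIidPl cT) in oT.
have /card_gt0P[u uc] : 0 < #|c| by lia.
have /independentP/(_ T) := circuit_indep_del cc uc.
rewrite (setIidPl (subset_trans (subD1set c u) cT)).
by move: oT; rewrite (cardsD1 u c) uc; lia.
Qed.

(** The intersection S of T and T' is a lattice triangle containing c. As c minus a point is
    independent, S has size at least [tsize T], so S is T. *)
Lemma oversaturated_least n (c : {set up n}) (T T' : lattice_triangle n) :
  circuit c -> strictly_oversaturated c T -> c \subset ups_in T' ->
  [/\ tx T' <= tx T, ty T' <= ty T
    & tx T + ty T + tsize T <= tx T' + ty T' + tsize T'].
Proof.
move=> cc oT cT'; have [cT ck] := circuit_oversaturated cc oT.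
have /card_gt0P[u uc] : 0 < #|c| by lia.
have := subsetP cT u uc; have := subsetP cT' u uc; rewrite !ups_inE => u1 u2.
pose a := maxn (tx T) (tx T'); pose b := maxn (ty T) (ty T').
pose k := minn (tx T + ty T + tsize T) (tx T' + ty T' + tsize T') - (a + b).
have [_ ?] := tri_le T.
have [||S [Sa Sb Sk]] := @tri_ex n a b k; try by rewrite /k /a /b; lia.
have cS : c \subset ups_in S.
  apply/subsetP => v vc; have := subsetP cT v vc; have := subsetP cT' v vc.
  by rewrite !ups_inE Sa Sb Sk /k /a /b; lia.
have := independentP _ (circuit_indep_del cc uc) S.
rewrite (setIidPl (subset_trans (subD1set c u) cS)) Sk.
move: ck; rewrite (cardsD1 u c) uc /k /a /b => ck le_k.
by split; lia.
Qed.

Lemma circuit_dependent n (c : {set up n}) : circuit c ->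
  exists T, strictly_oversaturated c T.
Proof.
case/minsetP; rewrite negb_forall => /existsP[T hT] _.
by exists T; rewrite /strictly_oversaturated ltnNge.
Qed.

Lemma circuit_hull n (c : {set up n}) : circuit c ->
  exists2 H, triangular_hull c H &
    forall T : lattice_triangle n, strictly_oversaturated c T <-> T = H.
Proof.
move=> cc; have [H oH] := circuit_dependent cc.
have [cH _] := circuit_oversaturated cc oH.
exists H.
  split=> // T cT; have [h1 h2 h3] := oversaturated_least cc oH cT.
  apply/subsetP => -[u|d].
    have := ups_inE H u; have := ups_inE T u; rewrite !inE; lia.
  have := downs_inE H d; have := downs_inE T d; rewrite !inE; lia.
move=> T; split=> [oT|-> //].
have [cT _] := circuit_oversaturated cc oT.
have [h1 h2 h3] := oversaturated_least cc oH cT.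
have [h4 h5 h6] := oversaturated_least cc oT cH.
by apply: tri_inj; lia.
Qed.

(** * Tilings *)

Definition downs_of n (R : {set unit_triangle n}) : {set down n} :=
  [set d | inr d \in R].
Definition ups_of n (R : {set unit_triangle n}) : {set up n} :=
  [set u | inl u \in R].

Definition tile n (R : {set unit_triangle n}) : bool :=
  [|| unit_rhombus R, type1_trapezoid R | type2_trapezoid R].

(** Rewrite rules that decide membership in explicit tiles. *)
Lemma sum_eqE (A B : eqType) :
  ((forall a a' : A, ((inl a : A + B) == inl a') = (a == a')) *
   (forall b b' : B, ((inr b : A + B) == inr b') = (b == b')) *
   (forall (a : A) (b : B), ((inl a : A + B) == inr b) = false) *
   (forall (a : A) (b : B), ((inr b : A + B) == inl a) = false))%type.
Proof. by do !split=> //; move=> a b; apply/eqP/eqP => [[]|->]. Qed.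

Lemma tile_down n (R : {set unit_triangle n}) d :
  tile R -> d \in downs_of R -> exists2 u, u \in ups_of R & adj d u.
Proof.
case/or3P.
- case/existsP=> s /existsP[t /andP[st /eqP ->]]; rewrite inE.
  move: s t st => [u|e] [v|e'] st;
    rewrite !(in_set, in_setU, in_set1) ?sum_eqE ?orbF //=;
    move=> /eqP de.
  + by exists u; rewrite ?(in_set, in_setU, in_set1) ?eqxx //= de -share_edge_ud.
  + by exists v; rewrite ?(in_set, in_setU, in_set1) ?eqxx ?orbT //= de -share_edge_du.
  + by rewrite share_edge_dd in st.
- case/existsP=> e /existsP[u /existsP[v /and4P[_ eu _ /eqP ->]]].
  rewrite !(in_set, in_setU, in_set1) ?sum_eqE => /eqP ->.
  by exists u; rewrite ?(in_set, in_setU, in_set1) ?eqxx // -share_edge_du.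
- case/existsP=> u /existsP[e /existsP[e' /and4P[_ ue ue' /eqP ->]]].
  rewrite !(in_set, in_setU, in_set1) ?sum_eqE ?orbF => de.
  exists u; first by rewrite !(in_set, in_setU, in_set1) eqxx !orbT.
  by rewrite -share_edge_ud; case/orP: de => /eqP ->.
Qed.

Lemma card_downs_of n (R : {set unit_triangle n}) :
  tile R -> #|downs_of R| <= 1 + type2_trapezoid R.
Proof.
have le1 (S : {set down n}) d b : S \subset [set d] -> #|S| <= 1 + b.
  by move/subset_leq_card; rewrite cards1; lia.
case/or3P.
- case/existsP=> s /existsP[t /andP[st /eqP ->]].
  move: s t st => [u|e] [v|e'] st.
  + rewrite (_ : downs_of _ = set0) ?cards0 //.
    by apply/setP => d; rewrite !(in_set, in_setU, in_set1).
  + by apply: (le1 _ e'); apply/subsetP => d;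
      rewrite !(in_set, in_setU, in_set1) !sum_eqE.
  + by apply: (le1 _ e); apply/subsetP => d;
      rewrite !(in_set, in_setU, in_set1) !sum_eqE ?orbF.
  + by rewrite share_edge_dd in st.
- case/existsP=> e /existsP[u /existsP[v /and4P[_ eu _ /eqP ->]]].
  by apply: (le1 _ e); apply/subsetP => d;
      rewrite !(in_set, in_setU, in_set1) !sum_eqE.
- move=> R2; rewrite R2; move: R2.
  case/existsP=> u /existsP[e /existsP[e' /and4P[_ ue ue' /eqP ->]]].
  apply: leq_trans (_ : #|[set e; e']| <= _); last by rewrite cards2; lia.
  by apply/subset_leq_card/subsetP => d;
      rewrite !(in_set, in_setU, in_set1) !sum_eqE ?orbF.
Qed.

Lemma tiling_oversaturation n (c : {set up n}) P (T : lattice_triangle n) :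
  rt_tiling (complement_region c) P ->
  #|c :&: ups_in T| <= tsize T + num_type2 P.
Proof.
case=> partP tileP.
have sumE (K : pred (unit_triangle n)) :
    #|[set x in complement_region c | K x]| = \sum_(R in P) #|[set x in R | K x]|.
  rewrite -sum1_card (eq_bigl (fun x => (x \in complement_region c) && K x)).
    rewrite (set_partition_big_cond _ partP); apply: eq_bigr => R _.
    by rewrite -sum1_card; apply: eq_bigl => x; rewrite inE.
  by move=> x; rewrite inE.
have downsE : #|downs_in T| =
    \sum_(R in P) #|downs_of R :&: downs_in T|.
  have injr : injective (@inr (up n) (down n)) by move=> d e [].
  rewrite -(card_imset _ injr).
  transitivity (\sum_(R in P) #|[set x in R | x \in inr @: downs_in T]|).
    rewrite -sumE; congr #|pred_of_set _|; apply/setP => x; rewrite in_set.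
    apply/idP/andP => [xT|[]//]; split=> //; case/imsetP: xT => d _ ->.
    by rewrite inE; apply/imsetP => -[].
  apply: eq_bigr => R _; rewrite -[RHS](card_imset _ injr).
  congr #|pred_of_set _|; apply/setP => x; rewrite in_set.
  apply/andP/imsetP => [[xR /imsetP[d dT xd]]|[d]].
    by exists d => //; rewrite in_setI dT inE -xd xR.
  by case/setIP; rewrite inE => dR dT ->; split=> //; apply: imset_f.
have upsE : #|ups_in T :\: c| =
    \sum_(R in P) #|ups_of R :&: (ups_in T :\: c)|.
  have injl : injective (@inl (up n) (down n)) by move=> d e [].
  rewrite -(card_imset _ injl).
  transitivity (\sum_(R in P) #|[set x in R | x \in inl @: (ups_in T :\: c)]|).
    rewrite -sumE; congr #|pred_of_set _|; apply/setP => x; rewrite in_set.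
    apply/idP/andP => [xT|[]//]; split=> //; case/imsetP: xT => u /setDP[_ uc] ->.
    by rewrite inE; apply: contra uc => /imsetP[v vc [->]].
  apply: eq_bigr => R _; rewrite -[RHS](card_imset _ injl).
  congr #|pred_of_set _|; apply/setP => x; rewrite in_set.
  apply/andP/imsetP => [[xR /imsetP[d dT xd]]|[d]].
    by exists d => //; rewrite in_setI dT inE -xd xR.
  by case/setIP; rewrite inE => dR dT ->; split=> //; apply: imset_f.
have num2 : num_type2 P = \sum_(R in P) type2_trapezoid R.
  rewrite /num_type2 -sum1_card big_mkcond /= [RHS]big_mkcond /=.
  by apply: eq_bigr => R _; rewrite inE; case: (R \in P) => //=; case: ifP.
(* Proved tile by tile: a tile with a downward unit in T has an upward one in T outside c, and only
   a type-2 trapezoid has a second downward unit. *)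
have : #|downs_in T| <= #|ups_in T :\: c| + num_type2 P.
  rewrite downsE upsE num2 -big_split /=; apply: leq_sum => R RP.
  have tR : tile R := tileP R RP.
  have [->|] := eqVneq (downs_of R :&: downs_in T) set0; first by rewrite cards0.
  case/set0Pn => d /setIP[dR dT].
  have [u uR du] := tile_down tR dR.
  have uc : u \notin c.
    have : inl u \in complement_region c.
      by rewrite -(cover_partition partP); apply/bigcupP; exists R; rewrite inE in uR.
    by rewrite inE; apply: contra => uc; apply: imset_f.
  have : 0 < #|ups_of R :&: (ups_in T :\: c)|.
    by apply/card_gt0P; exists u; rewrite in_setI uR in_setD uc; apply: adj_in du.
  rewrite -(leq_add2r (type2_trapezoid R)); apply: leq_trans.
  apply: leq_trans (card_downs_of tR).
  exact/subset_leq_card/subsetIl.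
have := cardsID c (ups_in T); rewrite card_ups_in setIC; lia.
Qed.

(* T_n is cut into the rows below T, then the columns to the left of T, then  *)
(* the diagonals above T. In each of them, an upward triangle is sent to the  *)
(* next downward one, and the last one to the previous downward one.          *)
Lemma outer_assignment n (T : lattice_triangle n) (d0 : down n) :
  exists g : up n -> down n,
    (forall u, u \notin ups_in T -> adj (g u) u /\ g u \notin downs_in T) /\
    (forall d, d \notin downs_in T -> exists u v,
       [/\ u \notin ups_in T, v \notin ups_in T &
         forall w, w \notin ups_in T -> (g w == d) = (w == u) || (w == v)]).
Proof.
have [k0 hT] := tri_le T.
pose a := tx T; pose b := ty T; pose k := tsize T.
(* The branches are the rows below T, the columns to its left and the diagonals above it; the last
   unit of a diagonal is the one with x = a. *)
pose G x y := if y < b then (if x + y + 1 < n then (x, y) else (x.-1, y))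
  else if x < a then (if x + y + 1 < n then (x, y) else (x, y.-1))
  else if a < x then (x.-1, y) else (x, y.-1).
have /fin_all_exists[g gP] (u : up n) : exists d : down n,
    u \notin ups_in T -> dx d = (G (ux u) (uy u)).1 /\ dy d = (G (ux u) (uy u)).2.
  have [_|uT] := boolP (u \in ups_in T); first by exists d0.
  have hu := up_lt u; move: uT; rewrite ups_inE => uT.
  have [|d [d1 d2]] := @down_ex n (G (ux u) (uy u)).1 (G (ux u) (uy u)).2.
    by rewrite /G; repeat case: ifP => ? /=; lia.
  by exists d.
exists g; split=> [u uT|d dT].
  have [] := gP u uT; have := up_lt u; move: uT.
  by rewrite ups_inE downs_inE /adj /G; repeat case: ifP => ? /=; lia.
have hd := down_lt d; move: dT; rewrite downs_inE => dT.
(* The fibre of d is given by coordinates. Its two points may coincide, which yields a rhombus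
   instead of a type-1 trapezoid. *)
have wit x y x' y' : x + y < n -> x' + y' < n ->
    ~~ [&& a <= x, b <= y & x + y < a + b + k] ->
    ~~ [&& a <= x', b <= y' & x' + y' < a + b + k] ->
    (forall z t, z + t < n -> ~~ [&& a <= z, b <= t & z + t < a + b + k] ->
      (G z t == (dx d, dy d)) = ((z == x) && (t == y)) || ((z == x') && (t == y'))) ->
    exists u v, [/\ u \notin ups_in T, v \notin ups_in T &
         forall w, w \notin ups_in T -> (g w == d) = (w == u) || (w == v)].
  move=> /up_ex[u [u1 u2]] /up_ex[v [v1 v2]] uT vT h; exists u, v.
  rewrite !ups_inE u1 u2 v1 v2; split=> // w wT.
  have [g1 g2] := gP w wT; have hw := up_lt w; rewrite ups_inE in wT.
  have eqE (z t : up n) : (z == t) = (ux z == ux t) && (uy z == uy t).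
    by apply/eqP/andP => [->//|[/eqP e1 /eqP e2]]; apply: up_inj.
  rewrite !eqE u1 u2 v1 v2 -h //.
  apply/eqP/eqP => [<-|e]; first by rewrite g1 g2; case: (G _ _).
  by apply: down_inj; rewrite ?g1 ?g2 e.
have [hb|hb] := ltnP (dy d) b.
  have [hs|hs] := ltnP (dx d + dy d + 2) n.
    apply: (wit (dx d) (dy d) (dx d) (dy d)); [lia|lia|lia|lia|].
    by move=> z t zt zT; rewrite /G; repeat case: ifP => ?; rewrite xpair_eqE; lia.
  apply: (wit (dx d) (dy d) (dx d).+1 (dy d)); [lia|lia|lia|lia|].
  by move=> z t zt zT; rewrite /G; repeat case: ifP => ?; rewrite xpair_eqE; lia.
have [ha|ha] := ltnP (dx d) a.
  have [hs|hs] := ltnP (dx d + dy d + 2) n.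
    apply: (wit (dx d) (dy d) (dx d) (dy d)); [lia|lia|lia|lia|].
    by move=> z t zt zT; rewrite /G; repeat case: ifP => ?; rewrite xpair_eqE; lia.
  apply: (wit (dx d) (dy d) (dx d) (dy d).+1); [lia|lia|lia|lia|].
  by move=> z t zt zT; rewrite /G; repeat case: ifP => ?; rewrite xpair_eqE; lia.
have [hs|hs] := ltnP a (dx d).
  apply: (wit (dx d).+1 (dy d) (dx d).+1 (dy d)); [lia|lia|lia|lia|].
  by move=> z t zt zT; rewrite /G; repeat case: ifP => ?; rewrite xpair_eqE; lia.
apply: (wit (dx d).+1 (dy d) (dx d) (dy d).+1); [lia|lia|lia|lia|].
by move=> z t zt zT; rewrite /G; repeat case: ifP => ?; rewrite xpair_eqE; lia.
Qed.

Lemma in_complement_inl n (c : {set up n}) u :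
  (inl u \in complement_region c) = (u \notin c).
Proof.
rewrite in_setC; congr (~~ _); apply/imsetP/idP => [[v vc [->]]//|uc].
by exists u.
Qed.

Lemma in_complement_inr n (c : {set up n}) d :
  inr d \in complement_region c.
Proof. by rewrite in_setC; apply/imsetP => -[]. Qed.

(* The tiles are {d} together with the u such that g u = d, for d != d0; the  *)
(* triangle d0 is added to the tile of v0.                                    *)
Lemma tiling_of_assignment n (c : {set up n}) (g : up n -> down n) d0 v0 :
  v0 \notin c -> adj d0 v0 ->
  (forall u, u \notin c -> adj (g u) u /\ g u != d0) ->
  (forall u, u \notin c -> g u = g v0 -> u = v0) ->
  (forall d, d != d0 -> exists u v, [/\ u \notin c, v \notin c &
     forall w, w \notin c -> (g w == d) = (w == u) || (w == v)]) ->
  exists2 P, rt_tiling (complement_region c) P & num_type2 P = 1.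
Proof.
move=> v0c dv0 gP gv0 gfib.
pose D := complement_region c.
(* [F] labels a unit triangle by the downward unit naming its tile; d0 takes the label of v0. The
   tiles are the fibres of [F]. *)
pose F (t : unit_triangle n) : down n :=
  match t with inl u => g u | inr d => if d == d0 then g v0 else d end.
have FN t : t \in D -> F t != d0.
  case: t => [u|d]; first by rewrite in_complement_inl => /gP[].
  by move=> _ /=; case: ifP => [_|->//]; have [] := gP v0 v0c.
pose P := preim_partition F D.
have partP : partition P D := preim_partitionP F D.
have PF R s t : R \in P -> s \in R -> t \in R -> F s = F t.
  by case/imsetP => x _ ->; rewrite !inE => /andP[_ /eqP <-] /andP[_ /eqP <-].
have PE R : R \in P -> exists2 e, e != d0 & R = [set t in D | F t == e].
  case/imsetP => x xD ->; exists (F x); first exact: FN.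
  by apply/setP => t; rewrite !inE eq_sym.
have classify R : R \in P -> tile R /\ (inr d0 \in R -> type2_trapezoid R).
  case/PE => e ed0 RE; have [ev0|ev0] := eqVneq e (g v0).
    suff R2 : type2_trapezoid R by rewrite /tile R2 !orbT.
    apply/existsP; exists v0; apply/existsP; exists d0; apply/existsP; exists e.
    rewrite eq_sym ed0 !share_edge_ud dv0 ev0; have [-> _] := gP v0 v0c.
    apply/eqP/setP => -[u|d]; rewrite RE in_set !in_setU !in_set1.
      rewrite in_complement_inl !sum_eqE /= ev0.
      by apply/andP/eqP => [[uc /eqP/(gv0 u uc)]//|->].
    rewrite in_complement_inr !sum_eqE ?orbF /= ev0.
    by have [->|dd0] := eqVneq d d0; rewrite ?eqxx.
  have d0R : inr d0 \notin R by rewrite RE inE negb_and /= eqxx eq_sym ev0 orbT.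
  split; last by rewrite (negPf d0R).
  have [u [v [uc vc fib]]] := gfib e ed0.
  have /gP[adju _] := uc; have /gP[adjv _] := vc.
  have gu : g u = e by apply/eqP; rewrite fib // eqxx.
  have gv : g v = e by apply/eqP; rewrite fib // eqxx orbT.
  rewrite gu in adju; rewrite gv in adjv.
  have Rinl w : (inl w \in R) = (w == u) || (w == v).
    rewrite RE in_set in_complement_inl /=.
    have [wc|wc] /= := boolP (w \in c); last exact: fib.
    by apply/esym/negP => /orP[] /eqP ew; move: wc; rewrite ew ?(negPf uc) ?(negPf vc).
  have Rinr d : (inr d \in R) = (d == e).
    rewrite RE in_set in_complement_inr /=; case: (eqVneq d d0) => [->|//].
    by rewrite eq_sym (negPf ev0) eq_sym (negPf ed0).
  rewrite /tile; have [uv|uv] := eqVneq u v.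
    apply/orP; left; apply/existsP; exists (inr e); apply/existsP; exists (inl u).
    rewrite share_edge_du adju; apply/eqP/setP => -[w|d]; rewrite !in_setU !in_set1.
      by rewrite Rinl -uv orbb !sum_eqE ?orbF.
    by rewrite Rinr !sum_eqE ?orbF.
  apply/orP; right; apply/orP; left; apply/existsP; exists e.
  apply/existsP; exists u; apply/existsP; exists v.
  rewrite uv !share_edge_du adju adjv; apply/eqP/setP => -[w|d];
    rewrite !in_setU !in_set1.
    by rewrite Rinl !sum_eqE ?orbF.
  by rewrite Rinr !sum_eqE.
exists P; first by split=> // R /classify[].
have d0P : inr d0 \in cover P by rewrite (cover_partition partP) in_complement_inr.
rewrite /num_type2 (_ : [set R in P | _] = [set pblock P (inr d0)]) ?cards1 //.
apply/setP => R; rewrite in_set1 in_set; apply/andP/eqP => [[RP]|->].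
  (* Two distinct downward units with the same label must include d0, so a type-2 tile is the block
     of d0. *)
  case/existsP => u /existsP[d /existsP[e /and4P[de _ _ /eqP RE]]].
  have /and3P[_ trivP _] := partP; apply/esym/def_pblock => //.
  have dR : inr d \in R by rewrite RE !in_setU !in_set1 eqxx.
  have eR : inr e \in R by rewrite RE !in_setU !in_set1 eqxx orbT.
  have := PF R _ _ RP dR eR; rewrite /=.
  case: eqP => [<- //|_]; case: eqP => [<- //|_ ded].
  by rewrite ded eqxx in de.
have RP := pblock_mem d0P; split=> //.
by have [_] := classify _ RP; apply; rewrite mem_pblock.
Qed.

Lemma circuit_tiling n (c : {set up n}) : 4 <= #|c| -> circuit c ->
  exists2 P, rt_tiling (complement_region c) P & num_type2 P = 1.
Proof.
move=> c4 cc; have [H oH] := circuit_dependent cc.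
have [cH ck] := circuit_oversaturated cc oH.
have /card_gt0P[u0 u0c] : 0 < #|c| by lia.
pose s := c :\ u0.
have [f [f_inj fadj fs]] := independent_matching (circuit_indep_del cc u0c).
have sH : s \subset ups_in H := subset_trans (subD1set c u0) cH.
have sk : #|s| = tsize H by move: ck; rewrite (cardsD1 u0 c) u0c => -[].
have fH d : d \in downs_in H -> f d \in ups_in H.
  by move=> dH; apply: adj_in dH (fadj d).
(* Both sides have the same size because [#|s| = tsize H], so the matching is onto here. *)
have imf : f @: downs_in H = ups_in H :\: s.
  apply/eqP; rewrite eqEcard; apply/andP; split.
    by apply/subsetP => _ /imsetP[d dH ->]; rewrite in_setD fs fH.
  by rewrite cardsD (setIidPr sH) sk card_ups_in addnK card_imset.
have [d0 d0H fd0] : exists2 d0, d0 \in downs_in H & u0 = f d0.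
  by apply/imsetP; rewrite imf in_setD setD11 (subsetP cH).
have [v0 dv0 v0c] : exists2 v, adj d0 v & v \notin c.
  have [/subsetPn[v]|] := boolP (~~ (nbr d0 \subset c)).
    by rewrite in_set; exists v.
  (* If c contained all three neighbours of d0, the triangle of size 2 around d0 would be
     over-saturated, forcing [#|c| = 3]. *)
  rewrite negbK => sub; have hd := down_lt d0.
  have [|T [Tx Ty Tk]] := @tri_ex n (dx d0) (dy d0) 2 isT; first lia.
  have oT : strictly_oversaturated c T.
    rewrite /strictly_oversaturated Tk -[X in X < _]/2 -(card_nbr d0).
    apply: subset_leq_card; rewrite subsetI sub.
    by apply/subsetP => u; rewrite in_set ups_inE Tx Ty Tk /adj; lia.
  by have [_] := circuit_oversaturated cc oT; rewrite Tk; lia.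
have [g [gadj gfib]] := outer_assignment H d0.
(* Inside H, [h] inverts the matching; the default d0 is taken only on s, which lies in c and is not
   tiled. *)
pose h u := if u \in ups_in H then odflt d0 [pick d | f d == u] else g u.
have hf d : d \in downs_in H -> h (f d) = d.
  move=> dH; rewrite /h fH //; case: pickP => [e /eqP/f_inj //|/(_ d)].
  by rewrite eqxx.
have hout u : u \notin ups_in H -> h u = g u by rewrite /h => /negPf ->.
have hin u : u \notin c -> u \in ups_in H ->
    exists d, [/\ d \in downs_in H, d != d0 & f d = u].
  move=> uc uH; have : u \in f @: downs_in H.
    by rewrite imf in_setD uH in_setD1 (negPf uc) andbF.
  case/imsetP => d dH ud; exists d; split=> //.
  by apply: contra uc => /eqP dd0; rewrite ud dd0 -fd0.
have outc u : u \notin ups_in H -> u \notin c.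
  by apply: contra; apply: (subsetP cH).
apply: (@tiling_of_assignment n c h d0 v0) => // [u uc|u uc|d dd0].
- have [uH|uH] := boolP (u \in ups_in H).
    by have [d [dH dd0 <-]] := hin u uc uH; rewrite hf.
  rewrite hout //; have [-> gu] := gadj u uH; split=> //.
  by apply: contra gu => /eqP ->.
- have [e [eH _ <-]] := hin v0 v0c (adj_in d0H dv0); rewrite hf //.
  have [uH|uH] := boolP (u \in ups_in H).
    by have [d [dH dd0 <-]] := hin u uc uH; rewrite hf // => ->.
  rewrite hout // => ge; have [_] := gadj u uH; by rewrite ge eH.
have [dH|dH] := boolP (d \in downs_in H).
  have fdc : f d \notin c.
    have := fs d; rewrite in_setD1 negb_and negbK => /orP[/eqP|//].
    by rewrite fd0 => /f_inj dd; rewrite dd eqxx in dd0.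
  exists (f d), (f d); split=> // w wc; rewrite orbb.
  have [wH|wH] := boolP (w \in ups_in H).
    by have [e [eH _ <-]] := hin w wc wH; rewrite hf // (inj_eq f_inj).
  rewrite hout //; have [_ gw] := gadj w wH.
  transitivity false; first by apply/eqP => gd; rewrite gd dH in gw.
  by apply/esym/eqP => wf; rewrite wf fH in wH.
have [u [v [uH vH fib]]] := gfib d dH; exists u, v; split; try exact: outc.
move=> w wc; have [wH|wH] := boolP (w \in ups_in H); last by rewrite hout // fib.
have [e [eH _ fe]] := hin w wc wH; rewrite -fe hf // fe.
transitivity false; first by apply/eqP => ed; rewrite -ed eH in dH.
by apply/esym/negP => /orP[] /eqP ew; move: wH; rewrite ew ?(negPf uH) ?(negPf vH).
Qed.

Theorem theorem5p8 (n : nat) (c : {set up n}) (hc : 4 <= #|c|) :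
  circuit c <->
  (exists2 H : lattice_triangle n, triangular_hull c H &
     forall T : lattice_triangle n, strictly_oversaturated c T <-> T = H) /\
  min_type2 (complement_region c) 1.
Proof.
split=> [cc|[[H [cH _] overH] [[P tilP numP] _]]].
  split; first exact: circuit_hull.
  split=> [|P tilP]; first exact: circuit_tiling.
  have [T oT] := circuit_dependent cc.
  by have := tiling_oversaturation T tilP; move: oT; rewrite /strictly_oversaturated; lia.
have /overH oH := erefl H.
(* This gives [#|c| <= tsize H + 1]. A dependent subset B of c over-saturates some T, which must be
   H, so B has at least [tsize H + 1] elements and equals c. *)
have ck := tiling_oversaturation H tilP.
rewrite (setIidPl cH) numP addn1 in ck.
apply/minsetP; split.
  by apply/independentP => /(_ H); rewrite leqNgt; move/negP; apply.
move=> B; rewrite negb_forall => /existsP[T]; rewrite -ltnNge => oB Bc.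
have oT : strictly_oversaturated c T.
  by apply: leq_trans oB _; apply/subset_leq_card/setSI.
have TH : T = H by apply/overH.
apply/eqP; rewrite eqEcard Bc (leq_trans ck) //.
rewrite TH in oB; apply: leq_trans oB _; exact/subset_leq_card/subsetIl.
Qed.
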